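(* Let $\Psi=\sum_{j=1}^N c_j\,\mathbf{w}(f_j,g_j)$ with $c_j\in\mathbb{C}$, $g_j\in\mathbb{Q}$, and pairwise distinct frequencies $f_1,\dots,f_N\in\mathbb{Q}/\mathbb{Z}$. Then $$\|\Psi\|^2=\langle\Psi,\Psi\rangle=\sum_{j=1}^N|c_j|^2.$$
   Context: For $f\in\mathbb{Q}/\mathbb{Z}$ and $g\in\mathbb{Q}$, $\mathbf{w}(f,g):\mathbb{Z}\to\mathbb{C}$ is the sequence $\mathbf{w}(f,g)[m]=\exp(2\pi i(fm+g))$. $\mathcal{V}=\operatorname{span}_{\mathbb{C}}\{\mathbf{w}(f,g)\mid f\in\mathbb{Q}/\mathbb{Z},\,g\in\mathbb{Q}\}$; every element of $\mathcal{V}$ is periodic. For $u,v\in\mathcal{V}$ with fundamental periods $n_u,n_v$, the principal period inner product is $\langle u,v\rangle=\frac1L\sum_{m=1}^L u[m]\overline{v[m]}$ with $L=\operatorname{lcm}(n_u,n_v)$, and the norm is $\|u\|=\sqrt{\langle u,u\rangle}$. *)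

(* Defs.v *)
From HB Require Import structures.
From mathcomp Require Import all_boot all_order all_algebra.
From mathcomp Require Import complex.
From mathcomp Require Import all_classical all_reals all_analysis.

Set Implicit Arguments.
Unset Strict Implicit.
Unset Printing Implicit Defensive.

Import Order.TTheory GRing.Theory Num.Theory.

Local Open Scope complex_scope.
Local Open Scope classical_set_scope.
Local Open Scope ring_scope.

(* Z as an additive subgroup of Q; int_num_subdef is the predicate under the
   qualifier Num.int *)
Definition ZinQ : zmodClosed rat :=
  GRing.ZmodClosed.clone rat (@Num.int_num_subdef rat) _.

Definition QmodZ : Type := {ideal_quot ZinQ}.
HB.instance Definition _ := Choice.on QmodZ.
HB.instance Definition _ := EqQuotient.on QmodZ.
HB.instance Definition _ := GRing.Zmodule.on QmodZ.

Lemma QmodZ_eqE (p q : rat) :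
  (\pi_QmodZ p = \pi_QmodZ q)%qT <-> p - q \is a Num.int.
Proof.
have -> : (p - q \is a Num.int) = (p - q \in ZinQ) by [].
by rewrite Quotient.idealrBE; split => /eqP.
Qed.

Definition cexp (R : realType) (z : R[i]) : R[i] :=
  (expR (complex.Re z))%:C * (cos (complex.Im z) +i* sin (complex.Im z)).

(* repr f is an arbitrary rational representative of f; wE shows that the
   choice is irrelevant *)
Definition w (R : realType) (f : QmodZ) (g : rat) : int -> R[i] :=
  fun m => cexp (2%:R * pi%:C * 'i%C * ratr (repr f * m%:~R + g)).

Definition calV (R : realType) : set (int -> R[i]) :=
  [set u | exists (N : nat) (c : 'I_N -> R[i]) (f : 'I_N -> QmodZ)
                  (g : 'I_N -> rat), u = \sum_(j < N) c j *: w R (f j) (g j)].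

Definition is_period (R : realType) (u : int -> R[i]) (n : nat) : Prop :=
  (0 < n)%N /\ periodic u n%:Z.

(* the least positive period of u; the value 0 for a non-periodic u is
   irrelevant on calV, see calV_fund_period *)
Definition fund_period (R : realType) (u : int -> R[i]) : nat :=
  if pselect (exists n, `[< is_period u n >]) is left ex_n
  then ex_minn ex_n else 0%N.

Definition pp_inner (R : realType) (u v : int -> R[i]) : R[i] :=
  let L := lcmn (fund_period u) (fund_period v) in
  L%:R^-1 * \sum_(1 <= m < L.+1) u m%:Z * (v m%:Z)^*.

Definition pp_norm (R : realType) (u : int -> R[i]) : R[i] :=
  sqrtC (pp_inner u u).

Section Facts.
Variable R : realType.
Implicit Types (u : int -> R[i]) (f : QmodZ) (g p q : rat).

Let cis (x : R) : R[i] := cos x +i* sin x.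

Let cisDint x k : cis (x + 2%:R * pi * k%:~R) = cis x.
Proof.
have D n y : cis (y + 2%:R * pi * n%:R) = cis y.
  rewrite (_ : 2%:R * pi * n%:R = pi *+ 2 *+ n); last first.
    by rewrite [2%:R * _]mulr_natl mulr_natr.
  by rewrite /cis (periodicn (@cosD2pi R)) (periodicn (@sinD2pi R)).
case: k => n; first exact: D.
by rewrite -[LHS](D n.+1) NegzE mulrNz mulrN addrNK.
Qed.

Let cexpE q : cexp (2%:R * pi%:C * 'i%C * ratr q) = cis (2%:R * pi * ratr q).
Proof.
have -> : 2%:R * pi%:C * 'i%C * ratr q =
          0 +i* (2%:R * pi * ratr q) :> R[i].
  have -> : ratr q = (ratr q : R)%:C by rewrite fmorph_rat.
  rewrite -(rmorph_nat (real_complex R)) -rmorphM mulrAC -rmorphM /=.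
  by simpc.
by rewrite /cexp /= expR0 mul1r.
Qed.

Lemma wE q g (m : int) :
  w R (\pi_QmodZ q)%qT g m = cexp (2%:R * pi%:C * 'i%C * ratr (q * m%:~R + g)).
Proof.
rewrite /w !cexpE.
have /QmodZ_eqE/intrP[k kE] : (\pi_QmodZ (repr (\pi_QmodZ q)) = \pi_QmodZ q)%qT.
  by rewrite reprK.
rewrite -[in RHS](cisDint _ (k * m)); congr cis.
rewrite -mulrDr; congr (_ * _).
rewrite -(ratr_int R (k * m)) -rmorphD /= intrM -kE; congr ratr.
by rewrite mulrBl [RHS]addrAC subrKC.
Qed.

Lemma calV_periodic u : calV u -> exists n, is_period u n.
Proof.
move=> [N [c [f [g ->]]]].
pose d j : nat := `|denq (repr (f j))|%N.
have d0 j : (0 < d j)%N by rewrite absz_gt0 denq_neq0.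
exists (\prod_(j < N) d j)%N; split; first by rewrite prodn_gt0.
move=> m; rewrite !fct_sumE; apply: eq_bigr => j _.
rewrite /GRing.scale /= /w !cexpE; congr (_ * _).
rewrite (bigD1 j) //=; set r := (\prod_(_ < _ | _) _)%N.
rewrite -[in RHS](cisDint _ (numq (repr (f j)) * r%:Z)); congr cis.
rewrite -mulrDr; congr (_ * _).
rewrite -(ratr_int R) -rmorphD /=; congr ratr.
rewrite addrAC intrD PoszM mulrDr 2!intrM; congr (_ + _ + _).
rewrite mulrA /d gtz0_abs ?denq_gt0 //; congr (_ * _).
by rewrite -[X in X * _]divq_num_den divfK // intr_eq0 denq_neq0.
Qed.

Lemma calV_fund_period u : calV u ->
  is_period u (fund_period u) /\
  forall n, is_period u n -> (fund_period u <= n)%N.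
Proof.
move=> /calV_periodic[n un]; rewrite /fund_period.
case: pselect => [ex|[]]; last by exists n; apply/asboolP.
case: ex_minnP => k /asboolP uk kmin; split=> // l ul.
by apply: kmin; apply/asboolP.
Qed.

Lemma pp_inner_ge0 u : 0 <= pp_inner u u.
Proof.
by rewrite mulr_ge0 ?invr_ge0 ?ler0n // sumr_ge0 // => m _; exact: mul_conjC_ge0.
Qed.

End Facts.

(* Main.v *)
Require Import Defs.
From HB Require Import structures.
From mathcomp Require Import all_boot all_order all_algebra.
From mathcomp Require Import complex lra.
From mathcomp Require Import all_classical all_reals all_analysis.

Set Implicit Arguments.
Unset Strict Implicit.
Unset Printing Implicit Defensive.

Import Order.TTheory GRing.Theory Num.Theory.

Local Open Scope ring_scope.

(** This is Parseval's identity for finite exponential sums.  Writing [e q] for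
    [exp (2 pi i q)] and [q j] for a rational representative of [f j], the
    sequence is [Psi m = sum_j a_j * e (q j) ^+ m] with [a_j = c_j * e (g_j)],
    so that [`|a_j| = `|c_j|].  The map [e] is a homomorphism from the rationals
    to the unit circle whose kernel is exactly the integers ([exp2pi_eq1]);
    hence distinct frequencies give distinct roots of unity [e (q j)], all of
    them [M]-th roots for a common [M], namely the product of the denominators
    of the [q j].  Over [M] consecutive terms the geometric sequences of
    distinct [M]-th roots of unity are orthogonal ([sum_expr_unity_root]), which
    gives the mean value [sum_j `|a_j| ^+ 2] ([parseval_unity_roots]).

    The inner product averages over the fundamental period [L] of [Psi] rather
    than over [M].  No relation between [L] and [M] has to be established:
    the averages of [`|Psi m| ^+ 2] over [L] and over [M] terms both agree with
    the average over [L * M] terms ([mean_period_eq]). *)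

Section Means.
Variable F : numFieldType.

Lemma sum_period_mul (h : nat -> F) (n k : nat) :
  (forall m, h (m + n)%N = h m) ->
  \sum_(0 <= m < k * n) h m = k%:R * \sum_(0 <= m < n) h m.
Proof.
move=> hn; have hk i m : h (m + i * n)%N = h m.
  by elim: i => [|i IH]; rewrite ?addn0 // mulSnr addnA hn.
rewrite big_nat_mul (eq_bigr (fun=> \sum_(0 <= m < n) h m)) => [|i _].
  by rewrite sumr_const_nat subn0 mulr_natl.
rewrite -{1}[(i * n)%N]add0n big_addn mulSn addnK.
by apply: eq_bigr => m _; rewrite hk.
Qed.

(** Both sides are the mean over [n * k] terms. *)
Lemma mean_period_eq (h : nat -> F) (n k : nat) :
  (0 < n)%N -> (0 < k)%N ->
  (forall m, h (m + n)%N = h m) -> (forall m, h (m + k)%N = h m) ->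
  n%:R^-1 * \sum_(0 <= m < n) h m = k%:R^-1 * \sum_(0 <= m < k) h m.
Proof.
move=> n0 k0 hn hk.
have nE : n%:R != 0 :> F by rewrite pnatr_eq0 -lt0n.
have kE : k%:R != 0 :> F by rewrite pnatr_eq0 -lt0n.
apply: (mulfI nE); apply: (mulfI kE); rewrite mulVKf // [k%:R * (_ * _)]mulrCA.
by rewrite mulVKf // -!sum_period_mul // mulnC.
Qed.

End Means.

Section Roots.
Variable C : numClosedFieldType.

Lemma sum_expr_unity_root (x : C) (M : nat) :
  x ^+ M = 1 -> x != 1 -> \sum_(m < M) x ^+ m = 0.
Proof.
rewrite -subr_eq0 => xM x1; apply: (mulfI x1).
by rewrite -subrX1 xM subrr mulr0.
Qed.

Lemma conjC_unity_root (x : C) (M : nat) :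
  (0 < M)%N -> x ^+ M = 1 -> x^* = x^-1.
Proof.
move=> M0 xM; rewrite invC_norm.
suff -> : `|x| = 1 by rewrite expr1n invr1 mul1r.
by apply/eqP; rewrite -(pexpr_eq1 M0) // -normrX xM normr1.
Qed.

(** Expanding the square, the cross term of [j] and [k] is a multiple of the
    sum of the powers of [z j / z k], an [M]-th root of unity that equals [1]
    only for [j = k]. *)
Lemma parseval_unity_roots (N M : nat) (a z : 'I_N -> C) :
  injective z -> (forall j, z j ^+ M = 1) ->
  \sum_(0 <= m < M) (\sum_j a j * z j ^+ m) * (\sum_j a j * z j ^+ m)^* =
  M%:R * \sum_j `|a j| ^+ 2.
Proof.
have [->|M0 z_inj zM] := posnP M; first by rewrite big_nil mul0r.
have z0 j : z j != 0.
  apply: contra_eq_neq (zM j) => ->.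
  by rewrite expr0n gtn_eqF // eq_sym oner_neq0.
rewrite big_mkord; under eq_bigr do rewrite rmorph_sum mulr_suml.
rewrite exchange_big mulr_sumr; apply: eq_bigr => j _ /=.
under eq_bigr do rewrite mulr_sumr.
rewrite exchange_big (bigD1 j) //= [X in _ + X]big1 ?addr0 => [|k kj].
  rewrite (eq_bigr (fun=> `|a j| ^+ 2)) => [|m _].
    by rewrite sumr_const card_ord mulr_natl.
  rewrite -normCK normrM exprMn normrX -exprM mulnC exprM (normCK (z j)).
  by rewrite (conjC_unity_root M0 (zM j)) mulfV // expr1n mulr1.
rewrite (eq_bigr (fun m : 'I_M => a j * (a k)^* * (z j / z k) ^+ m)) => [|m _].
  rewrite -mulr_sumr sum_expr_unity_root ?mulr0 //.
    by rewrite expr_div_n !zM divr1.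
  apply: contraNneq kj => /divr1_eq /z_inj -> //.
rewrite rmorphM rmorphXn /= (conjC_unity_root M0 (zM k)).
by rewrite mulrACA exprMn.
Qed.

End Roots.

Section Exp.
Variable R : realType.
Implicit Types p q : rat.

(** The argument of [cexp] has the shape it takes in [w], so that [w R f g m]
    is [exp2pi (repr f * m%:~R + g)] by definition. *)
Definition exp2pi q : R[i] := cexp (2%:R * pi%:C%C * 'i%C * ratr q).

Lemma exp2piE q :
  exp2pi q = (cos (pi * ratr q *+ 2) +i* sin (pi * ratr q *+ 2))%C.
Proof.
rewrite /exp2pi.
have -> : 2%:R * pi%:C%C * 'i%C * ratr q =
          (0 +i* (pi * ratr q *+ 2))%C :> R[i].
  have -> : ratr q = (ratr q : R)%:C%C :> R[i] by rewrite fmorph_rat.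
  rewrite -(rmorph_nat (real_complex R)) -rmorphM mulrAC -rmorphM /=.
  by simpc; rewrite -mulrA mulr_natl.
by rewrite /cexp /= expR0 mul1r.
Qed.

Lemma exp2piD p q : exp2pi (p + q) = exp2pi p * exp2pi q.
Proof.
rewrite !exp2piE rmorphD /= mulrDr mulrnDl.
move: (pi * ratr p *+ 2) (pi * ratr q *+ 2) => x y.
by rewrite cosD sinD [sin x * _ + _]addrC; simpc.
Qed.

Lemma exp2pi0 : exp2pi 0 = 1.
Proof. by rewrite exp2piE rmorph0 mulr0 mul0rn cos0 sin0. Qed.

Lemma exp2piM q n : exp2pi (q * n%:R) = exp2pi q ^+ n.
Proof.
elim: n => [|n IH]; first by rewrite mulr0 exp2pi0.
by rewrite -addn1 natrD mulrDr mulr1 exp2piD IH exprD.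
Qed.

Lemma exp2piN q : exp2pi (- q) = (exp2pi q)^*.
Proof. by rewrite !exp2piE rmorphN mulrN mulNrn cosN sinN. Qed.

Lemma norm_exp2pi q : `|exp2pi q| = 1.
Proof.
by apply/eqP; rewrite -sqrp_eq1 // normCK -exp2piN -exp2piD subrr exp2pi0.
Qed.

Lemma exp2pi_int q : q \is a Num.int -> exp2pi q = 1.
Proof.
have nat1 n : exp2pi n%:R = 1.
  rewrite -[n%:R]mul1r exp2piM exp2piE rmorph1 mulr1 cos2pi.
  by rewrite sin_mulr2n sinpi mulr0 mul0rn expr1n.
case/intrP=> -[] n ->; first exact: nat1.
by rewrite NegzE mulrNz exp2piN (nat1 n.+1) rmorph1.
Qed.

(** Modulo integers [0 <= q < 1], and [cos (2 pi q) = 1] means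
    [sin (pi q) = 0], which the positivity of [sin] on [(0, pi)] excludes
    unless [q = 0]. *)
Lemma exp2pi_eq1 q : exp2pi q = 1 -> q \is a Num.int.
Proof.
move=> eq1; have /andP[kq qk] := floor_itv q; set k := Num.floor q in kq qk.
pose r := q - k%:~R.
have r0 : 0 <= r by rewrite subr_ge0.
have r1 : r < 1 by rewrite ltrBlDl -[1]/(1%:~R) -intrD.
have : exp2pi r = 1.
  by rewrite exp2piD eq1 mul1r exp2pi_int // rpredN intr_int.
rewrite exp2piE => -[cos1 _].
have sin0 : sin (pi * ratr r : R) = 0.
  apply/eqP; rewrite -sqrf_eq0; apply/eqP.
  move: cos1 (cos2Dsin2 (pi * ratr r : R)).
  by rewrite cos_mulr2n; lra.
have [rE|rN] := eqVneq r 0.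
  by rewrite -[q](subrK k%:~R) -/r rE add0r intr_int.
have : 0 < sin (pi * ratr r : R).
  apply: sin_gt0_pi; rewrite mulr_gt0 ?pi_gt0 //=.
    2: by rewrite ltr0q lt_def rN.
  by rewrite -[ltRHS]mulr1 ltr_pM2l ?pi_gt0 // -[1](rmorph1 ratr) ltr_rat.
by rewrite sin0 ltxx.
Qed.

Lemma exp2pi_inj_mod p q : exp2pi p = exp2pi q -> p - q \is a Num.int.
Proof.
by move=> epq; apply: exp2pi_eq1; rewrite exp2piD epq -exp2piD subrr exp2pi0.
Qed.

End Exp.

Theorem corollary9p4 (R : realType) (N : nat) (c : 'I_N -> R[i])
    (f : 'I_N -> QmodZ) (g : 'I_N -> rat) (f_distinct : injective f) :
  let Psi : int -> R[i] := \sum_(j < N) c j *: w R (f j) (g j) in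
  pp_norm Psi ^+ 2 = pp_inner Psi Psi /\
  pp_inner Psi Psi = \sum_(j < N) `|c j| ^+ 2.
Proof.
move=> Psi; split; first exact: sqrtCK.
pose q j := repr (f j).
pose a j := c j * exp2pi R (g j); pose z j := exp2pi R (q j).
have PsiE (m : nat) : Psi m%:Z = \sum_j a j * z j ^+ m.
  rewrite /Psi fct_sumE; apply: eq_bigr => j _.
  rewrite -[LHS]/(c j * exp2pi R _) exp2piD /a -mulrA -exp2piM.
  by rewrite [exp2pi R (g j) * _]mulrC.
have z_inj : injective z.
  move=> j k /exp2pi_inj_mod /QmodZ_eqE; rewrite !reprK; exact: f_distinct.
pose d j := `|denq (q j)|%N; pose M := (\prod_j d j)%N.
have M0 : (0 < M)%N by rewrite prodn_gt0 // => j; rewrite absz_gt0 denq_neq0.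
have zM j : z j ^+ M = 1.
  rewrite /M (bigD1 j) //= exprM -exp2piM exp2pi_int ?expr1n //.
  have -> : (d j)%:R = (denq (q j))%:~R :> rat.
    by rewrite -[LHS]/((d j)%:Z%:~R) /d gtz0_abs ?denq_gt0.
  by rewrite -numqE intr_int.
have VPsi : calV Psi by exists N, c, f, g.
have [[L0 PsiL] _] := calV_fund_period VPsi.
rewrite /pp_inner /lcmn gcdnn mulnK //; move: (fund_period Psi) => L in L0 PsiL *.
pose h (m : nat) := Psi m%:Z * (Psi m%:Z)^*.
have hL m : h (m + L)%N = h m by rewrite /h PoszD PsiL.
have PsiM (m : nat) : Psi (m + M)%N%:Z = Psi m%:Z.
  by rewrite !PsiE; apply: eq_bigr => j _; rewrite exprD zM mulr1.
have hM m : h (m + M)%N = h m by rewrite /h PsiM.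
have -> : \sum_(1 <= m < L.+1) h m = \sum_(0 <= m < L) h m.
  (* the two windows differ by the values at [0] and at [L], which agree *)
  apply: (addrI (h 0%N)); rewrite -big_ltn // big_nat_recr //=.
  by rewrite -[in h L](add0n L) hL addrC.
rewrite (mean_period_eq L0 M0 hL hM) /h; under eq_bigr do rewrite !PsiE.
rewrite parseval_unity_roots // mulKf ?pnatr_eq0 -?lt0n //.
by apply: eq_bigr => j _; rewrite normrM norm_exp2pi mulr1.
Qed.
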